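(* Let $(X,T)$ be a t.d.s. The following statements are equivalent: (1) $(X,T)$ is uniformly rigid; (2) $(K(X),T_K)$ is uniformly rigid; (3) $(K(X),T_K)$ is rigid; (4) $(K(X),T_K)$ is weakly rigid.
   Context: A t.d.s. is a pair $(X,T)$ with $X$ a compact metric space and $T:X\to X$ a continuous surjective map; it is invertible if $T$ is a homeomorphism. $K(X)$ is the set of non-empty closed subsets of $X$ with the Hausdorff metric, and $T_K:K(X)\to K(X)$, $T_K(A)=T(A)$; $(K(X),T_K)$ is again a t.d.s. The following notions apply to any t.d.s. $(X,T)$. $(X,T)$ is rigid if there is a sequence of positive integers $m_i\to\infty$ with $T^{m_i}\to\mathrm{id}$ pointwise, and uniformly rigid if there is a sequence of positive integers $m_i\to\infty$ with $T^{m_i}\to\mathrm{id}$ uniformly (invertibility is not assumed in these two definitions). For an invertible t.d.s., a point $x$ is recurrent if there is a sequence of integers $n_i\to+\infty$ or a sequence $n_i\to-\infty$ with $T^{n_i}x\to x$. A t.d.s. $(X,T)$ is weakly rigid if it is invertible and for each $n\in\mathbb{N}=\{1,2,\dots\}$ every point $(x_1,\dots,x_n)\in X^n$ is recurrent for the product system $(X^n,T^{(n)})$, $T^{(n)}=T\times\cdots\times T$ ($n$ times). *)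

(* Defs.v *)
From HB Require Import structures.
From mathcomp Require Import all_boot all_order all_algebra.
From mathcomp Require Import all_classical all_reals all_analysis.

Set Implicit Arguments.
Unset Strict Implicit.
Unset Printing Implicit Defensive.

Import Order.TTheory GRing.Theory Num.Theory.
Import numFieldNormedType.Exports.

Local Open Scope classical_set_scope.
Local Open Scope ring_scope.

HB.mixin Record isCompactSpace T & Topological T := {
  compact_space : compact [set: T]
}.

#[short(type="compactMetricType")]
HB.structure Definition CompactMetric (R : numDomainType) :=
  { T of Metric R T & isCompactSpace T }.

(* Compact metric spaces are allowed to be empty. *)
Record tds (R : realType) := Tds {
  tds_space :> compactMetricType R ;
  tds_map : tds_space -> tds_space ;
  tds_continuous : continuous tds_map ;
  tds_surjective : forall y, exists x, tds_map x = y
}.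

Section hyperspace.
Context {R : realType}.

Record hyperspace (X : compactMetricType R) := Hyperspace {
  hset :> set X ;
  hset_closed : closed hset ;
  hset_neq0 : hset !=set0
}.

HB.instance Definition _ (X : compactMetricType R) :=
  gen_eqMixin (hyperspace X).
HB.instance Definition _ (X : compactMetricType R) :=
  gen_choiceMixin (hyperspace X).

Context {X : compactMetricType R}.
Implicit Types (x y z : X) (A B C : hyperspace X).

Lemma hyperspace_ext A B : hset A = hset B -> A = B.
Proof.
case: A B => [A cA A0] [B cB B0] /= AB; subst B.
by congr Hyperspace; exact: Prop_irrelevance.
Qed.

Definition point_dist x (B : set X) : R := inf [set mdist x b | b in B].

Definition excess (A B : set X) : R := sup [set point_dist a B | a in A].

Definition hausdorff_dist A B : R := Num.max (excess A B) (excess B A).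

Lemma mdist_bounded : exists M : R, forall x y, mdist x y <= M.
Proof.
have [[x0 _]|/set0P/negP/negPn/eqP X0] := pselect ([set: X] !=set0); last first.
  by exists 0 => x; have : [set: X] x by []; rewrite X0.
have /compact_near_coveringP cX := @compact_space R X.
have : \forall M \near +oo, [set: X] `<=` (fun x => mdist x0 x <= M).
  apply: (cX R (pinfty_nbhs R) (fun M x => mdist x0 x <= M)) => x _.
  exists (ball x 1, [set M | mdist x0 x + 1 <= M]) => /=.
    split; first exact: nbhsx_ballx.
    by apply: nbhs_pinfty_ge; exact: num_real.
  move=> [y M] /= []; rewrite ballEmdist /= => xy; apply: le_trans.
  by rewrite (le_trans (metric_triangle _ x _))// lerD2l ltW.
move=> [M [Mr MP]]; exists ((M + 1) + (M + 1)) => x y.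
have H z : mdist x0 z <= M + 1 by apply: (MP (M + 1)) => //; rewrite ltrDl.
by rewrite (le_trans (metric_triangle _ x0 _))// lerD// metric_sym.
Qed.

Lemma point_dist_has_inf x B : has_inf [set mdist x b | b in (B : set X)].
Proof.
split; first by have [b Bb] := hset_neq0 B; exists (mdist x b), b.
by exists 0 => _ [b _ <-]; exact: mdist_ge0.
Qed.

Lemma point_dist_ge0 x B : 0 <= point_dist x B.
Proof.
apply: lb_le_inf; first by case: (point_dist_has_inf x B).
by move=> _ [b _ <-]; exact: mdist_ge0.
Qed.

Lemma point_dist_le x B b : hset B b -> point_dist x B <= mdist x b.
Proof.
by move=> Bb; apply: inf_lbound; [case: (point_dist_has_inf x B)|exists b].
Qed.

Lemma point_dist_lt x B e : point_dist x B < e ->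
  exists2 b, hset B b & mdist x b < e.
Proof.
move=> xB; have e0 : 0 < e - point_dist x B by rewrite subr_gt0.
have [_ [b Bb <-]] := inf_adherent e0 (point_dist_has_inf x B).
by rewrite addrC subrK => ?; exists b.
Qed.

Lemma point_dist_eq0 x B : point_dist x B <= 0 -> hset B x.
Proof.
move=> xB; apply: (@hset_closed X B x) => U /nbhs_ballP[e /= e0 eU].
have [b Bb xb] := point_dist_lt (le_lt_trans xB e0).
by exists b; split => //; apply: eU; rewrite ballEmdist.
Qed.

Lemma point_dist_triangle x y B : point_dist x B <= mdist x y + point_dist y B.
Proof.
apply/ler_addgt0Pl => e e0.
have [b Bb yb] : exists2 b, hset B b & mdist y b < point_dist y B + e.
  by apply: point_dist_lt; rewrite ltrDl.
rewrite (le_trans (point_dist_le x Bb))// (le_trans (metric_triangle _ y _))//.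
by rewrite addrCA lerD2l addrC ltW.
Qed.

Lemma excess_has_sup A B : has_sup [set point_dist a B | a in (A : set X)].
Proof.
split; first by have [a Aa] := hset_neq0 A; exists (point_dist a B), a.
have [M MP] := mdist_bounded; have [b Bb] := hset_neq0 B.
by exists M => _ [a _ <-]; exact: le_trans (point_dist_le _ Bb) _.
Qed.

Lemma excess_ge A B a : hset A a -> point_dist a B <= excess A B.
Proof.
by move=> Aa; apply: sup_upper_bound; [exact: excess_has_sup|exists a].
Qed.

Lemma excess_le A B e : (forall a, hset A a -> point_dist a B <= e) ->
  excess A B <= e.
Proof.
move=> AB; apply: ge_sup; first by case: (excess_has_sup A B).
by move=> _ [a Aa <-]; exact: AB.
Qed.

Lemma excess_triangle A B C : excess A C <= excess A B + excess B C.
Proof.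
apply: excess_le => a Aa; apply/ler_addgt0Pl => e e0.
have [b Bb ab] : exists2 b, hset B b & mdist a b < point_dist a B + e.
  by apply: point_dist_lt; rewrite ltrDl.
rewrite (le_trans (point_dist_triangle a b C))// addrA.
apply: lerD; last exact: excess_ge.
by apply: le_trans (ltW ab) _; rewrite [leLHS]addrC lerD2l; exact: excess_ge.
Qed.

Lemma excess_eq0 A B : excess A B <= 0 -> hset A `<=` hset B.
Proof.
by move=> AB a Aa; apply: point_dist_eq0; exact: le_trans (excess_ge _ Aa) AB.
Qed.

Let hausdorff_distxx A : hausdorff_dist A A = 0.
Proof.
have E0 : excess A A <= 0.
  by apply: excess_le => a Aa; rewrite -(mdistxx a); exact: point_dist_le.
rewrite /hausdorff_dist maxxx; apply/eqP; rewrite eq_le E0/=.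
have [a Aa] := hset_neq0 A.
exact: le_trans (point_dist_ge0 a A) (excess_ge _ Aa).
Qed.

Let hausdorff_dist_eq0 A B : hausdorff_dist A B = 0 -> A = B.
Proof.
move=> AB; have : hausdorff_dist A B <= 0 by rewrite AB.
rewrite /hausdorff_dist ge_max => /andP[/excess_eq0 ? /excess_eq0 ?].
by apply: hyperspace_ext; apply/seteqP.
Qed.

Let hausdorff_dist_sym A B : hausdorff_dist A B = hausdorff_dist B A.
Proof. exact: maxC. Qed.

Let hausdorff_dist_triangle B A C :
  hausdorff_dist A C <= hausdorff_dist A B + hausdorff_dist B C.
Proof.
rewrite {1}/hausdorff_dist ge_max; apply/andP; split.
  by rewrite (le_trans (excess_triangle A B C))// lerD// le_max lexx.
rewrite (le_trans (excess_triangle C B A))// addrC lerD// le_max lexx.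
  by rewrite orbT.
by rewrite orbT.
Qed.

HB.instance Definition _ := isMetric.Build R (hyperspace X)
  hausdorff_distxx hausdorff_dist_eq0 hausdorff_dist_sym
  hausdorff_dist_triangle.

Lemma hyperspace_mdistE A B : mdist A B = hausdorff_dist A B.
Proof. by []. Qed.

Lemma hausdorff_dist_lt A B e : hausdorff_dist A B < e ->
  forall a, hset A a -> exists2 b, hset B b & mdist a b < e.
Proof.
rewrite /hausdorff_dist gt_max => /andP[ABe _] a Aa.
by apply: point_dist_lt; exact: le_lt_trans (excess_ge _ Aa) ABe.
Qed.

Lemma hausdorff_dist_le A B e :
  (forall a, hset A a -> exists2 b, hset B b & mdist a b <= e) ->
  (forall b, hset B b -> exists2 a, hset A a & mdist b a <= e) ->
  hausdorff_dist A B <= e.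
Proof.
move=> AB BA; rewrite /hausdorff_dist ge_max; apply/andP; split;
  apply: excess_le => x.
  by move=> /AB[y By]; apply: le_trans; exact: point_dist_le.
by move=> /BA[y Ay]; apply: le_trans; exact: point_dist_le.
Qed.

Let hyperspace_compact : compact [set: hyperspace X].
Proof.
rewrite compact_ultra => F UF _.
pose hits x e := [set A | exists2 a, hset A a & mdist x a < e].
pose L : set X := [set x | forall e, 0 < e -> F (hits x e)].
have closed_compact (D : set X) : closed D -> compact D.
  by move=> cD; exact: subclosed_compact cD (@compact_space R X) _.
have misses (D : set X) : closed D -> (forall x, D x -> ~ L x) ->
    F [set A | forall x, D x -> ~ hset A x].
  move=> /closed_compact /compact_near_coveringP cD DL.
  apply: (cD _ F (fun A x => ~ hset A x)) => x /DL.
  move=> /existsNP[e /not_implyP[e0 nF]].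
  have [//|nhit] := in_ultra_setVsetC (hits x e) UF.
  exists (ball x e, ~` hits x e) => /=; first by split => //; exact: nbhsx_ballx.
  by move=> [y A] /= []; rewrite ballEmdist /= => xy nA Ay; apply: nA; exists y.
have clL : closed L.
  move=> x clx e e0.
  have e20 : 0 < e / 2 by rewrite divr_gt0.
  have [y [Ly]] := clx _ (nbhsx_ballx x (e / 2) e20).
  rewrite ballEmdist /= => xy.
  apply: filterS (Ly _ e20) => A [a Aa ya]; exists a => //.
  rewrite (le_lt_trans (metric_triangle _ y _))// [ltRHS]splitr.
  exact: ltrD.
have L0 : L !=set0.
  apply: contrapT => nL.
  have /filter_ex[A mA] : F [set A | forall x, setT x -> ~ hset A x].
    apply: misses; first exact: closedT.
    by move=> x _ Lx; apply: nL; exists x.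
  by have [a Aa] := hset_neq0 A; exact: (mA a).
exists (Hyperspace clL L0); split => //.
apply/metricType_numDomainType.fcvgrPdist_lt => e e0.
have e20 : 0 < e / 2 by rewrite divr_gt0.
have e40 : 0 < e / 2 / 2 by rewrite divr_gt0.
have near1 : F [set A | forall a, hset A a ->
    exists2 l, L l & mdist a l <= e / 2].
  pose U : set X := \bigcup_(l in L) (ball l (e / 2))°.
  have oU : open U by apply: bigcup_open => l _; exact: open_interior.
  have FU : F [set A | forall x, (~` U) x -> ~ hset A x].
    apply: misses; first exact: open_closedC.
    move=> x Ux Lx; apply: Ux; exists x => //.
    exact: nbhsx_ballx.
  apply: filterS FU => A AU a Aa.
  have [l Ll /interior_subset] : U a.
    by apply: contrapT => /AU; exact.
  by rewrite ballEmdist /= => la; exists l => //; rewrite metric_sym ltW.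
have near2 : F [set A | forall l, L l ->
    exists2 a, hset A a & mdist l a <= e / 2].
  have /compact_near_coveringP cL := closed_compact _ clL.
  apply: (cL _ F (fun A l => exists2 a, hset A a & mdist l a <= e / 2)).
  move=> x Lx; exists (ball x (e / 2 / 2), hits x (e / 2 / 2)) => /=.
    by split; [exact: nbhsx_ballx|exact: Lx].
  move=> [y A] /= []; rewrite ballEmdist /= => xy [a Aa xa]; exists a => //.
  rewrite (le_trans (metric_triangle _ x _))// [leRHS]splitr.
  by rewrite lerD// ltW// metric_sym.
apply: filterS2 near1 near2 => A A1 A2.
apply: (@le_lt_trans _ _ (e / 2)).
  exact: hausdorff_dist_le.
by rewrite ltr_pdivrMr// ltr_pMr// ltr1n.
Qed.

HB.instance Definition _ :=
  isCompactSpace.Build (hyperspace X) hyperspace_compact.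

End hyperspace.

Section hyperspace_system.
Context {R : realType} (S : tds R).
Local Notation T := (@tds_map R S).

Let image_closed (A : hyperspace S) : closed (T @` A).
Proof.
apply: compact_closed; first exact: metric_hausdorff.
apply: continuous_compact.
  by apply: continuous_subspaceT; exact: tds_continuous.
apply: subclosed_compact (@compact_space R S) _ => //.
exact: hset_closed.
Qed.

Let image_neq0 (A : hyperspace S) : (T @` A) !=set0.
Proof. by have [a Aa] := hset_neq0 A; exists (T a), a. Qed.

Definition hyperspace_map (A : hyperspace S) : hyperspace S :=
  Hyperspace (@image_closed A) (@image_neq0 A).

Lemma tds_map_unif (e : R) : 0 < e -> exists2 d : R, 0 < d &
  forall x y : S, mdist x y < d -> mdist (T x) (T y) < e.
Proof.
move=> e0; have e20 : 0 < e / 2 by rewrite divr_gt0.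
have /compact_near_coveringP cS := @compact_space R S.
have : \forall d \near 0^'+, [set: S] `<=`
    (fun x => forall y : S, mdist x y < d -> mdist (T x) (T y) < e).
  apply: (cS R (0^'+) (fun d x =>
    forall y : S, mdist x y < d -> mdist (T x) (T y) < e)) => x _.
  have /nbhs_ballP[r /= r0 rP] :=
    @tds_continuous R S x _ (nbhsx_ballx (T x) (e / 2) e20).
  have r20 : 0 < r / 2 by rewrite divr_gt0.
  exists (ball x (r / 2), [set d | d < r / 2]) => /=.
    split; first exact: nbhsx_ballx.
    exact: nbhs_right_lt.
  move=> [y d] /= []; rewrite ballEmdist /= => xy dr z yz.
  have xyr : mdist x y < r.
    by rewrite (lt_trans xy)// ltr_pdivrMr// ltr_pMr// ltr1n.
  have xzr : mdist x z < r.
    rewrite (le_lt_trans (metric_triangle _ y _))// [ltRHS]splitr.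
    by rewrite ltrD// (lt_trans yz).
  have := rP y; rewrite !ballEmdist /= => /(_ xyr) xTy.
  have := rP z; rewrite !ballEmdist /= => /(_ xzr) xTz.
  rewrite (le_lt_trans (metric_triangle _ (T x) _))// [ltRHS]splitr.
  by rewrite ltrD// metric_sym.
move=> H; near (0 : R)^'+ => d; exists d => //.
have : [set: S] `<=` (fun x => forall y : S, mdist x y < d ->
    mdist (T x) (T y) < e) by near: d.
by move=> dP x y; exact: dP.
Unshelve. all: by end_near. Qed.

Let hyperspace_map_continuous : continuous hyperspace_map.
Proof.
move=> A; apply/(metricType_numDomainType.cvgrPdist_le (F := nbhs A) _ (hyperspace_map A)) => e e0.
have [d d0 dP] := tds_map_unif e0.
apply/nbhs_ballP; exists d => //= B; rewrite ballEmdist /= => AB.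
apply: hausdorff_dist_le.
  move=> _ [a Aa <-]; have [b Bb ab] := hausdorff_dist_lt AB Aa.
  by exists (T b); [exists b|exact/ltW/dP].
have BA : mdist B A < d by rewrite metric_sym.
move=> _ [b Bb <-]; have [a Aa ba] := hausdorff_dist_lt BA Bb.
by exists (T a); [exists a|exact/ltW/dP].
Qed.

Let hyperspace_map_surjective (B : hyperspace S) :
  exists A, hyperspace_map A = B.
Proof.
have cA : closed (T @^-1` B).
  apply: closed_comp; last exact: hset_closed.
  by move=> x _; exact: tds_continuous.
have A0 : (T @^-1` B) !=set0.
  have [b Bb] := hset_neq0 B; have [a ab] := tds_surjective b.
  by exists a; rewrite /preimage /= ab.
exists (Hyperspace cA A0); apply: hyperspace_ext; apply/seteqP; split.
  by move=> _ [a /= Ba <-].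
by move=> b Bb; have [a ab] := tds_surjective b; exists a => //=; rewrite ab.
Qed.

Definition hyperspace_tds : tds R :=
  Tds hyperspace_map_continuous hyperspace_map_surjective.

End hyperspace_system.

Section rigidity.
Context {R : realType}.

Definition rigid (S : tds R) := exists m : nat -> nat,
  [/\ forall i, (0 < m i)%N, m @ \oo --> \oo &
      forall x : S, iter (m i) (@tds_map R S) x @[i --> \oo] --> x].

Definition uniformly_rigid (S : tds R) := exists m : nat -> nat,
  [/\ forall i, (0 < m i)%N, m @ \oo --> \oo &
      {uniform, (fun i => iter (m i) (@tds_map R S)) @ \oo --> id}].

(* For a bijective [f], ['pinv_id setT f] is the inverse function of [f]. *)
Definition fun_inv (X : Type) (f : X -> X) : X -> X := 'pinv_id [set: X] f.

Definition invertible (S : tds R) :=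
  bijective (@tds_map R S) /\ continuous (fun_inv (@tds_map R S)).

(* [int_iter f k] is the [k]-th power of the bijection [f]. *)
Definition int_iter (X : Type) (f : X -> X) (k : int) : X -> X :=
  match k with
  | Posz n => iter n f
  | Negz n => iter n.+1 (fun_inv f)
  end.

(* Only meaningful when [f] is a homeomorphism: negative [n i] use [fun_inv f]. *)
Definition recurrent (X : topologicalType) (f : X -> X) (x : X) :=
  exists n : nat -> int,
    ((n i)%:~R @[i --> \oo] --> (+oo : set_system R) \/
     (n i)%:~R @[i --> \oo] --> (-oo : set_system R)) /\
    int_iter f (n i) x @[i --> \oo] --> x.

Definition power_map (X : Type) (f : X -> X) (n : nat) (x : 'I_n -> X) :
  'I_n -> X := fun k => f (x k).

(* [{ptws 'I_n -> S}] is the set of [n]-tuples with the product topology. *)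
Definition weakly_rigid (S : tds R) := invertible S /\
  forall n : nat, (0 < n)%N -> forall x : {ptws 'I_n -> S},
    @recurrent {ptws 'I_n -> S} (@power_map S (@tds_map R S) n) x.

End rigidity.

(* Main.v *)
(* The only substantial implication is the last one.  Cover [X] by finitely many
   closed sets [A_1, ..., A_n] of small diameter.  Recurrence of the point
   [(A_1, ..., A_n)] of [K(X)^n] yields [k] with [|k|] large such that every
   [T^k A_i] is Hausdorff-close to [A_i], so that [T^k] is uniformly close to
   the identity; [T^{-k}] is then equally close to it, so the sign of [k] does
   not matter.  The three other implications hold along a fixed sequence
   [m_i]; that rigidity of [K(X)] makes [T_K] injective follows from uniqueness
   of limits, and its inverse is continuous by compactness. *)

From HB Require Import structures.
Require Import Defs.
From mathcomp Require Import all_boot all_order all_algebra.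
From mathcomp Require Import all_classical all_reals all_analysis.
From mathcomp Require Import lra.

Set Implicit Arguments.
Unset Strict Implicit.
Unset Printing Implicit Defensive.

Import Order.TTheory GRing.Theory Num.Theory.
Import numFieldNormedType.Exports.

Local Open Scope classical_set_scope.
Local Open Scope ring_scope.

(** * Uniform rigidity, and its passage to the hyperspace *)

Section uniform_rigidity.
Context {R : realType} (S : tds R).
Local Notation T := (@tds_map R S).

Lemma uniform_iter_cvgP (m : nat -> nat) :
  {uniform, (fun i => iter (m i) T) @ \oo --> id} <->
  forall e : R, 0 < e ->
    \forall i \near \oo, forall x : S, mdist x (iter (m i) T x) < e.
Proof.
split=> [mT e e0|mT P].
  have : nbhs (id : {uniform S -> S})
      [set h | forall x, mdist x (h x) < e].
    apply/uniform_nbhs; exists [set xy | ball xy.1 e xy.2]; split.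
      by rewrite -entourage_ballE; exists e.
    by move=> h hP x; have := hP x I; rewrite /= ballEmdist.
  exact: mT.
move=> /uniform_nbhs[E [+ EP]]; rewrite -entourage_ballE => -[e /= e0 eE].
apply: filterS (mT e e0) => i iP; apply: EP => x _.
by apply: eE => /=; rewrite ballEmdist; exact: iP.
Qed.

(** For each [i], pick a time beyond [i] that moves every point by less than [1/(i+1)]; these times
    form the required sequence. *)
Lemma uniformly_rigid_exists :
  (forall (e : R) (N : nat), 0 < e ->
    exists2 n, (N < n)%N & forall x : S, mdist x (iter n T x) < e) ->
  uniformly_rigid S.
Proof.
move=> H.
have /choice[m mP] : forall i : nat, exists n,
    (i < n)%N /\ forall x : S, mdist x (iter n T x) < i.+1%:R^-1 :> R.
  move=> i; have [|n ? ?] := H i.+1%:R^-1 i; first by rewrite invr_gt0 ltr0n.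
  by exists n.
exists m; split.
- by move=> i; rewrite (leq_ltn_trans _ (mP i).1).
- apply/cvgnyPge => N; near=> i.
  by rewrite (leq_trans _ (ltnW (mP i).1))//; near: i; exact: nbhs_infty_ge.
- apply/uniform_iter_cvgP => e e0; near=> i => x.
  rewrite (lt_trans ((mP i).2 x))//.
  by near: i; exact: near_infty_natSinv_lt (PosNum e0).
Unshelve. all: by end_near. Qed.

Lemma uniformly_rigid_rigid : uniformly_rigid S -> rigid S.
Proof.
move=> [m [m0 moo /uniform_iter_cvgP mT]]; exists m; split => // x.
apply/metricType_numDomainType.cvgrPdist_lt => e /mT.
exact: filterS.
Qed.

End uniform_rigidity.

Lemma hset_iter_hyperspace_map (R : realType) (S : tds R) n
    (A : hyperspace S) :
  hset (iter n (@hyperspace_map R S) A) = iter n (@tds_map R S) @` A.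
Proof.
elim: n => [|n IHn] /=; first by rewrite image_id.
by rewrite IHn image_comp.
Qed.

Lemma uniformly_rigid_hyperspace (R : realType) (S : tds R) :
  uniformly_rigid S -> uniformly_rigid (hyperspace_tds S).
Proof.
move=> [m [m0 moo /uniform_iter_cvgP mT]]; exists m; split => //.
apply/uniform_iter_cvgP => e e0.
have e20 : 0 < e / 2 by rewrite divr_gt0.
apply: filterS (mT _ e20) => i iP A.
(* Suprema turn strict pointwise bounds into a weak one, hence the margin [e / 2]. *)
apply: (@le_lt_trans _ _ (e / 2)); last by lra.
apply: hausdorff_dist_le => [a Aa|]; rewrite hset_iter_hyperspace_map.
  by exists (iter (m i) (@tds_map R S) a); [exists a|exact/ltW].
by move=> _ [a Aa <-]; exists a => //; rewrite metric_sym ltW.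
Qed.

(** * Inverses, product systems and weak rigidity *)

Section surjections.
Context {X : Type} (f : X -> X).
Hypothesis f_surj : forall y, exists x, f x = y.

Lemma fun_invK : cancel (fun_inv f) f.
Proof.
move=> y; rewrite /fun_inv pinvK//; apply/mem_set.
by have [x <-] := f_surj y; exists x.
Qed.

Lemma iter_fun_invK n : cancel (iter n (fun_inv f)) (iter n f).
Proof.
by elim: n => [//|n IHn] y; rewrite iterSr (iterS n (fun_inv f)) fun_invK IHn.
Qed.

Lemma power_map_surj n (y : 'I_n -> X) : exists x, power_map f x = y.
Proof.
have /choice[x xP] : forall k, exists x, f x = y k by move=> k; exact: f_surj.
by exists x; apply/funext.
Qed.

End surjections.

Lemma iter_power_map (X : Type) (f : X -> X) n k (x : 'I_n -> X) i :
  iter k (power_map f (n := n)) x i = iter k f (x i).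
Proof. by elim: k => //= k <-. Qed.

(** Preimages under the inverse are images under [f], and [f] maps closed sets to compact, hence
    closed, sets. *)
Lemma compact_bijective_inv (X : topologicalType) (f : X -> X) :
  hausdorff_space X -> compact [set: X] -> continuous f -> bijective f ->
  continuous (fun_inv f).
Proof.
move=> hX cX cf bf; apply/continuous_closedP => A cA.
have f_surj y : exists x, f x = y.
  by have [g _ fgK] := bf; exists (g y); rewrite fgK.
have -> : fun_inv f @^-1` A = f @` A.
  apply/seteqP; split=> [y Ay|_ [x Ax <-]].
    by exists (fun_inv f y) => //; exact: fun_invK.
  by rewrite /preimage /= (bij_inj bf (fun_invK f_surj (f x))).
apply: compact_closed => //; apply: continuous_compact.
  exact: continuous_subspaceT.
exact: subclosed_compact cA cX _.
Qed.

Lemma cvg_ptws (I : eqType) (X : topologicalType) (F : set_system (I -> X))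
    (x : {ptws I -> X}) : Filter F ->
  (F --> x) <-> forall i, (fun g => g i) @ F --> x i.
Proof.
move=> FF; split=> [Fx i|Fx].
  apply: cvg_trans (@proj_continuous I (fun=> X) i x).
  exact: cvg_app.
(* The product topology is the supremum of those induced by the evaluations, which are onto because
   of the constant functions. *)
apply/cvg_sup => i; apply/cvg_image.
  by apply/seteqP; split=> // y _; exists (fun=> y).
apply: cvg_trans (Fx i) => W /= FW; exists ((fun g => g i) @^-1` W) => //.
apply/seteqP; split=> [_ [g ? <-]//|y Wy]; by exists (fun=> y).
Qed.

Lemma rigid_weakly_rigid (R : realType) (S : tds R) :
  rigid S -> weakly_rigid S.
Proof.
move=> [m [m0 moo mT]]; split.
  have bT : bijective (@tds_map R S).
    have T_inj : injective (@tds_map R S).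
      (* Since [m i > 0], the orbits of [x] and [y] agree along [m], so [x] and [y] are limits of
         the same sequence. *)
      move=> x y Txy;
        apply: (@cvg_unique _ (@metric_hausdorff _ S) _ _ _ _ (mT x)).
      apply: cvg_trans (mT y); apply: near_eq_cvg; near=> i.
      by have := m0 i; case: (m i) => // k _; rewrite !iterSr Txy.
    apply: (Bijective (g := fun_inv (@tds_map R S))).
      by move=> x; apply/T_inj/fun_invK/tds_surjective.
    exact/fun_invK/tds_surjective.
  split=> //; apply: compact_bijective_inv => //.
  - exact: metric_hausdorff.
  - exact: compact_space.
  - exact: tds_continuous.
move=> n n0 x; exists (Posz \o m); split; first by left; exact/cvgrnyP.
apply/cvg_ptws => k; have := mT (x k).
by under eq_cvg do rewrite -iter_power_map.
Unshelve. all: by end_near. Qed.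

(** * From weak rigidity of the hyperspace to uniform rigidity *)

Lemma closed_cover (R : realType) (X : compactMetricType R) (x0 : X) (e : R) :
  0 < e -> exists n (A : 'I_n.+1 -> hyperspace X),
    (forall x, exists i, hset (A i) x) /\
    (forall i x y, hset (A i) x -> hset (A i) y -> mdist x y <= e).
Proof.
move=> e0; have e20 : 0 < e / 2 by rewrite divr_gt0.
pose B (c : X) : set X := [set x | mdist c x <= e / 2].
have cB c : closed (B c).
  move=> x clx; apply/ler_addgt0Pl => r r0.
  have [y [/= cy]] := clx _ (nbhsx_ballx x r r0).
  rewrite ballEmdist /= => xy; rewrite (le_trans (metric_triangle _ y _))//.
  by rewrite addrC lerD// metric_sym ltW.
have B0 c : B c !=set0 by exists c; rewrite /B /= mdistxx ltW.
(* [compact_cover] is only available for pointed spaces. *)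
pose pX : ptopologicalType :=
  HB.pack (CompactMetric.sort X) (isPointed.Build X x0).
have cX : cover_compact [set: pX].
  by rewrite -compact_cover; exact: (@compact_space R X).
have [] := cX X setT (fun c => (ball c (e / 2))°).
- by move=> c _; exact: open_interior.
- by move=> x _; exists x => //; exact: nbhsx_ballx.
(* Adding [x0] to the centres makes the list non-empty, so that its indices form some ['I_n.+1]. *)
move=> D _ XD; pose s : seq X := x0 :: finmap.enum_fset D.
exists (size s).-1, (fun i => Hyperspace (cB (nth x0 s i)) (B0 _)).
split=> [x|i x y /= xi yi].
  have [c /= cD /interior_subset] := XD x I; rewrite ballEmdist /= => cx.
  have cs : c \in s by rewrite inE; apply/orP; right.
  have ics : (index c s < (size s).-1.+1)%N by rewrite index_mem.
  by exists (Ordinal ics); rewrite /= nth_index// /B /= ltW.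
rewrite (le_trans (metric_triangle _ (nth x0 s i) _))// [leRHS]splitr.
by rewrite lerD// metric_sym.
Qed.

(* Both signs of the recurrence times are treated at once: [y] is [x] for a
   positive time, and [z] is [x] for a negative one. *)
Lemma recurrent_power_map (R : realType) (S : tds R) n
    (x : {ptws 'I_n -> S}) (e : R) (N : nat) : 0 < e ->
  @recurrent R {ptws 'I_n -> S} (@power_map S (@tds_map R S) n) x ->
  exists k (y z : 'I_n -> S), [/\ (N < k)%N, y = x \/ z = x,
    forall i, iter k (@tds_map R S) (y i) = z i,
    forall i, mdist (x i) (y i) < e & forall i, mdist (x i) (z i) < e].
Proof.
move=> e0 [t [too tx]].
have near_x : \forall j \near \oo, forall i,
    mdist (x i) (int_iter (@power_map S (@tds_map R S) n) (t j) x i) < e.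
  (* The coordinates are finitely many, so one threshold serves them all. *)
  apply: filter_forall => i; move/cvg_ptws : tx => /(_ i).
  by move=> /metricType_numDomainType.cvgrPdist_lt /(_ e e0).
have [too'|too'] := too.
  have /cvgryPgt/(_ N%:R) tN := too'.
  have [j [jx jN]] := filter_ex (filterI near_x tN).
  move: jN jx; case: (t j) => [k|k]; last first.
    by rewrite ltNge (le_trans _ (ler0n _ N))// NegzE mulrNz oppr_le0 ler0z.
  rewrite -pmulrn ltr_nat => Nk kx.
  exists k, x, (iter k (@power_map S (@tds_map R S) n) x); split => //.
  - by left.
  - by move=> i; rewrite iter_power_map.
  - by move=> i; rewrite mdistxx.
have /cvgrNyPlt/(_ (- N%:R)) tN := too'.
have [j [jx jN]] := filter_ex (filterI near_x tN).
move: jN jx; case: (t j) => [k|k].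
  by rewrite ltNge (le_trans (y := 0)) ?oppr_le0 ?ler0n// ler0z.
(* [Negz k] is [-(k + 1)]: the time [k.+1] leads from the backward iterate of [x] to [x] itself. *)
rewrite NegzE mulrNz ltrN2 -pmulrn ltr_nat => Nk kx.
exists k.+1, (iter k.+1 (fun_inv (@power_map S (@tds_map R S) n)) x), x.
split => //.
- by right.
- move=> i; rewrite -iter_power_map iter_fun_invK//.
  exact: power_map_surj (@tds_surjective _ S) _.
- by move=> i; rewrite mdistxx.
Qed.

(** Singletons embed the space in its hyperspace compatibly with the maps. *)
Lemma hyperspace_map_inj (R : realType) (S : tds R) :
  injective (@hyperspace_map R S) -> injective (@tds_map R S).
Proof.
move=> TK_inj x y Txy.
have closed1 (z : S) : closed [set z].
  by apply: compact_closed; [exact: metric_hausdorff|exact: compact_set1].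
pose A (z : S) := Hyperspace (closed1 z) (ex_intro [set z] z erefl).
have /(congr1 (@hset _ _)) Axy : A x = A y.
  by apply/TK_inj/hyperspace_ext; rewrite /= !image_set1 Txy.
have : hset (A x) x by [].
by rewrite Axy.
Qed.

Lemma weakly_rigid_hyperspace (R : realType) (S : tds R) :
  weakly_rigid (hyperspace_tds S) -> uniformly_rigid S.
Proof.
move=> [[TK_bij _] TK_rec]; apply: uniformly_rigid_exists => e N e0.
have [[x0 _]|/set0P/negP/negPn/eqP S0] := pselect ([set: S] !=set0); last first.
  by exists N.+1 => // x; have : [set: S] x by []; rewrite S0.
have T_inj := hyperspace_map_inj (bij_inj TK_bij).
(* The thirds pay for two Hausdorff distances and one diameter. *)
have e30 : 0 < e / 3 by rewrite divr_gt0.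
have [n [A [Acover Adiam]]] := closed_cover x0 e30.
have [k [B [C [Nk BC TBC AB AC]]]] :=
  recurrent_power_map N e30 (TK_rec n.+1 isT A).
exists k => // x.
have TB i : hset (C i) = iter k (@tds_map R S) @` B i.
  by rewrite -TBC; exact: hset_iter_hyperspace_map.
(* If [B = A], the sets [B i] cover. If [C = A], some [C i], the image of [B i], contains the image
   of [x], and injectivity puts [x] in [B i]. *)
have [i Bx] : exists i, hset (B i) x.
  case: BC => [->|CA]; first exact: Acover.
  have [i] := Acover (iter k (@tds_map R S) x).
  rewrite -[A i]/((A : {ptws _ -> _}) i) -CA TB => -[b Bb].
  have iter_inj : injective (iter k (@tds_map R S)).
    by elim: (k) => [//|l IHl] u v /= /T_inj/IHl.
  by move=> /iter_inj <-; exists i.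
have Cx : hset (C i) (iter k (@tds_map R S) x) by rewrite TB; exists x.
have BA : mdist (B i) (A i) < e / 3 by rewrite metric_sym.
have CA : mdist (C i) (A i) < e / 3 by rewrite metric_sym.
have [a Aa xa] := hausdorff_dist_lt BA Bx.
have [a' Aa' xa'] := hausdorff_dist_lt CA Cx.
have aa' := Adiam _ _ _ Aa Aa'.
have := metric_triangle x a (iter k (@tds_map R S) x).
have := metric_triangle a a' (iter k (@tds_map R S) x).
rewrite metric_sym in xa'.
by lra.
Qed.

Theorem theorem4p2 (R : realType) (S : tds R) :
  [<-> uniformly_rigid S;
       uniformly_rigid (hyperspace_tds S);
       rigid (hyperspace_tds S);
       weakly_rigid (hyperspace_tds S)].
Proof.
tfae.
- exact: uniformly_rigid_hyperspace.
- exact: uniformly_rigid_rigid.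
- exact: rigid_weakly_rigid.
- exact: weakly_rigid_hyperspace.
Qed.
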